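(* Let $\mathcal Q$ be a quantaloid endowed with an involution. The (symmetric version of the) adjunction $\mathcal C\Sigma\dashv P$ restricts to an equivalence of categories $$\mathrm{Cat}_{\mathrm s\kappa}(\mathcal Q)_f\;\simeq\;[\mathrm{Map}_{\mathrm s}(\mathcal Q)^{\mathrm{op}},\mathrm{Set}]_f,$$ where $\mathrm{Cat}_{\mathrm s\kappa}(\mathcal Q)_f$ is the full subcategory of the category $\mathrm{Cat}_{\mathrm s\kappa}(\mathcal Q)$ of symmetrically complete symmetric $\mathcal Q$-categories consisting of those $(\mathbb M,A)$ such that for all $a,b\in A$ $$\mathbb M(a,b)=\bigvee\{fg\mid x\in A,\ f:tx\to ta\text{ map},\ g:tb\to tx\text{ map},\ f\le\mathbb M(a,x),\ g\le\mathbb M(x,b)\},$$ and $[\mathrm{Map}_{\mathrm s}(\mathcal Q)^{\mathrm{op}},\mathrm{Set}]_f$ is the full subcategory of $[\mathrm{Map}_{\mathrm s}(\mathcal Q)^{\mathrm{op}},\mathrm{Set}]$ consisting of the presheaves $F$ satisfying the following two conditions, where $\mathbb M$ denotes the structural matrix of $\mathcal S\Sigma F$: 1. for every symmetric singleton $\sigma$ of $\mathcal S\Sigma F$ there is a covering family $(x_i,f_i)_{i\in I}$, with $x_i\in F(tx_i)$ and $f_i:tx_i\to t\sigma$ a symmetric map for every $i\in I$, such that $\sigma(a)f_i=\mathbb M(a,x_i)$ for all $a\in\Sigma F$ and $i\in I$; 2. for every covering family $(x_i,f_i)_{i\in I}$ with $x_i\in F(tx_i)$ and $f_i:tx_i\to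 q$ for a fixed $q\in\mathrm{Ob}(\mathcal Q)$, which is compatible in the sense that $f_i^\circ f_j\le\mathbb M(x_i,x_j)$ for all $i,j$, there exists a unique $x\in\Sigma F$ such that $F(f_i)(x)=x_i$ for all $i\in I$.
   Context: **Quantaloids.** A quantaloid $\mathcal Q$ is a locally posetal, locally cocomplete closed bicategory (hom-posets are complete lattices and composition preserves suprema in each variable); $gf$ means first $f$. An involution is an order-preserving $(-)^\circ:\mathcal Q^{\mathrm{op}}\to\mathcal Q$, identity on objects, with $f^{\circ\circ}=f$. A map is an arrow $f$ with a right adjoint $f^*$; it is a symmetric map if $f^*=f^\circ$. $\mathrm{Map}_{\mathrm s}(\mathcal Q)$ is the category of objects of $\mathcal Q$ and symmetric maps. A family $(f_i)_{i\in I}$ of maps into $q$ (here $(x_i,f_i)_{i\in I}$ with $f_i:tx_i\to q$) is covering if $\mathrm{id}_q\le\bigvee_{i\in I}f_if_i^\circ$. **$\mathcal Q$-categories.** A $\mathcal Q$-category $(\mathbb M,A)$ is a set $A$ with a typing $t:A\to\mathrm{Ob}(\mathcal Q)$ and arrows $\mathbb M(a,b):tb\to ta$ with $\mathbb M(a,b)\mathbb M(b,c)\le\mathbb M(a,c)$ and $\mathrm{id}_{ta}\le\mathbb M(a,a)$. A $\mathcal Q$-functor is a type-preserving function $f$ with $\mathbb M(a,a')\le\mathbb N(f(a),f(a'))$. $(\mathbb M,A)$ is symmetric if $\mathbb M(a,b)=\mathbb M(b,a)^\circ$, and skeletal if $\mathbb M(-,x)=\mathbb M(-,x')$ implies $x=x'$.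 **Singletons.** A symmetric singleton of a symmetric $(\mathbb M,A)$, of type $t\sigma\in\mathrm{Ob}(\mathcal Q)$, is a family $\sigma(a):t\sigma\to ta$ with $\mathbb M(a,b)\sigma(b)\le\sigma(a)$, $\mathrm{id}_{t\sigma}\le\bigvee_a\sigma(a)^\circ\sigma(a)$ and $\sigma(a)\sigma(b)^\circ\le\mathbb M(a,b)$. It is representable if $\sigma=\mathbb M(-,x)$ for some $x\in A$ with $tx=t\sigma$. A skeletal symmetric $(\mathbb M,A)$ is symmetrically complete if every symmetric singleton is representable; $\mathrm{Cat}_{\mathrm s\kappa}(\mathcal Q)$ is the category of these with $\mathcal Q$-functors. The symmetric completion $\mathcal C_{\mathrm s}(\mathbb M,A)$ has the symmetric singletons as elements and $\mathbb S(\sigma,\tau)=\bigvee_a\sigma(a)^\circ\tau(a)$. **The functors.** For $F:\mathrm{Map}_{\mathrm s}(\mathcal Q)^{\mathrm{op}}\to\mathrm{Set}$, $\Sigma F$ is the $\mathcal Q$-category with elements $\bigsqcup_xF(x)$ (elements of $F(x)$ have type $x$) and $\mathbb N(a,b)=\bigvee\{f:tb\to ta\text{ symmetric map}\mid F(f)(a)=b\}$. The symmetrization $\mathcal S(\mathbb N,A)$ has the same elements and matrix $\mathbb N(a,b)\wedge\mathbb N(b,a)^\circ$. For a symmetrically complete $(\mathbb M,A)$, $P_{\mathbb M,A}:\mathrm{Map}_{\mathrm s}(\mathcal Q)^{\mathrm{op}}\to\mathrm{Set}$ sends $x$ to the set of elements of type $x$ and $\gamma:x\to y$ to the function $a\mapsto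 a\cdot\gamma$, the unique element with $\mathbb M(-,a\cdot\gamma)=\mathbb M(-,a)\gamma$. The symmetric adjunction is $\mathcal C_{\mathrm s}\mathcal S\Sigma\dashv P$.
   Formalization: In the condition defining Cat_sκ(Q)_f, ''map'' is taken to mean ''symmetric map'' (with arbitrary maps the equivalence fails); the restricted functors form an equivalence with the canonical unit and counit, while the unrestricted adjunction, false for the functors as given, is not asserted. *)

(* Defs.v *)
From mathcomp Require Import ssreflect ssrfun ssrbool boolp classical_sets.

Set Implicit Arguments.
Unset Strict Implicit.
Unset Printing Implicit Defensive.

Local Open Scope classical_set_scope.

Record category := Category {
  ob :> Type;
  hom : ob -> ob -> Type;
  idc : forall x, hom x x;
  compc : forall x y z, hom y z -> hom x y -> hom x z;
  compcA : forall w x y z (h : hom y z) (g : hom x y) (f : hom w x),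
    compc h (compc g f) = compc (compc h g) f;
  comp1c : forall x y (f : hom x y), compc (idc y) f = f;
  compc1 : forall x y (f : hom x y), compc f (idc x) = f }.

Arguments hom {c} x y.
Arguments idc {c} x.
Arguments compc {c x y z} g f : rename.

Definition is_iso (C : category) (x y : C) (f : hom x y) : Prop :=
  exists g : hom y x, compc g f = idc x /\ compc f g = idc y.

Definition opposite (C : category) : category :=
  @Category C (fun x y => hom y x) (fun x => idc x) (fun _ _ _ g f => compc f g)
    (fun _ _ _ _ h g f => esym (compcA f g h))
    (fun _ _ f => compc1 f) (fun _ _ f => comp1c f).

Definition Sets : category :=
  @Category Type (fun A B => A -> B) (fun _ a => a) (fun _ _ _ g f a => g (f a))
    (fun _ _ _ _ _ _ _ => erefl) (fun _ _ _ => erefl) (fun _ _ _ => erefl).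

Definition full_sub (C : category) (P : C -> Prop) : category :=
  @Category {x : C | P x} (fun x y => hom (sval x) (sval y))
    (fun x => idc (sval x)) (fun _ _ _ g f => compc g f)
    (fun _ _ _ _ h g f => compcA h g f)
    (fun _ _ f => comp1c f) (fun _ _ f => compc1 f).

Record functor (C D : category) := Functor {
  fobj :> C -> D;
  fmap : forall x y, hom x y -> hom (fobj x) (fobj y);
  fmap1 : forall x, fmap (idc x) = idc (fobj x);
  fmapM : forall x y z (g : hom y z) (f : hom x y),
    fmap (compc g f) = compc (fmap g) (fmap f) }.

Arguments fmap {C D} f {x y} _ : rename.

Definition id_functor (C : category) : functor C C :=
  @Functor C C id (fun _ _ f => f) (fun _ => erefl) (fun _ _ _ _ _ => erefl).

Definition comp_functor (C D E : category) (G : functor D E) (F : functor C D) :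
  functor C E.
Proof.
refine (@Functor C E (fun x => G (F x)) (fun _ _ f => fmap G (fmap F f)) _ _).
- by move=> x; rewrite !fmap1.
- by move=> x y z g f; rewrite !fmapM.
Defined.

Definition restrict_functor (C D : category) (P : C -> Prop) (P' : D -> Prop)
    (F : functor C D) (FP : forall x, P x -> P' (F x)) :
  functor (full_sub P) (full_sub P') :=
  @Functor (full_sub P) (full_sub P')
    (fun x => exist P' (F (sval x)) (FP _ (svalP x)))
    (fun _ _ f => fmap F f) (fun x => fmap1 F (sval x))
    (fun _ _ _ g f => fmapM F g f).

Record nat_trans (C D : category) (F G : functor C D) := NatTrans {
  component :> forall x, hom (F x) (G x);
  naturality : forall x y (f : hom x y),
    compc (component y) (fmap F f) = compc (fmap G f) (component x) }.

Lemma nat_trans_ext (C D : category) (F G : functor C D) (u v : nat_trans F G) :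
  (forall x, u x = v x) -> u = v.
Proof.
case: u v => [u nu] [v nv] /= uv.
have e : u = v by apply: functional_extensionality_dep.
by subst v; congr NatTrans; apply: Prop_irrelevance.
Qed.

Definition id_nat (C D : category) (F : functor C D) : nat_trans F F.
Proof.
by refine (@NatTrans C D F F (fun x => idc (F x)) _) => x y f; rewrite comp1c compc1.
Defined.

Definition comp_nat (C D : category) (F G H : functor C D)
  (v : nat_trans G H) (u : nat_trans F G) : nat_trans F H.
Proof.
refine (@NatTrans C D F H (fun x => compc (v x) (u x)) _) => x y f.
by rewrite -compcA naturality compcA naturality compcA.
Defined.

Definition functor_cat (C D : category) : category.
Proof.
refine (@Category (functor C D) (@nat_trans C D) (@id_nat C D) (@comp_nat C D) _ _ _).
- by move=> w x y z h g f; apply: nat_trans_ext => c /=; rewrite compcA.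
- by move=> x y f; apply: nat_trans_ext => c /=; rewrite comp1c.
- by move=> x y f; apply: nat_trans_ext => c /=; rewrite compc1.
Defined.

Record adjoint_equivalence (C D : category) (L : functor C D) (R : functor D C) :=
  AdjointEquivalence {
  ae_unit : nat_trans (id_functor C) (comp_functor R L);
  ae_counit : nat_trans (comp_functor L R) (id_functor D);
  ae_triangleL : forall x : C,
    compc (ae_counit (L x)) (fmap L (ae_unit x)) = idc (L x);
  ae_triangleR : forall y : D,
    compc (fmap R (ae_counit y)) (ae_unit (R y)) = idc (R y);
  ae_unit_iso : forall x : C, is_iso (ae_unit x);
  ae_counit_iso : forall y : D, is_iso (ae_counit y) }.

(* [qcomp g f] is "first f, then g". Closedness of the bicategory is the
   preservation of suprema in each variable. *)
Record quantaloid := Quantaloid {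
  qob :> Type;
  qhom : qob -> qob -> Type;
  qid : forall x, qhom x x;
  qcomp : forall x y z, qhom y z -> qhom x y -> qhom x z;
  qle : forall x y, qhom x y -> qhom x y -> Prop;
  qsup : forall x y, set (qhom x y) -> qhom x y;
  qcompA : forall w x y z (h : qhom y z) (g : qhom x y) (f : qhom w x),
    qcomp h (qcomp g f) = qcomp (qcomp h g) f;
  qcomp1l : forall x y (f : qhom x y), qcomp (qid y) f = f;
  qcomp1r : forall x y (f : qhom x y), qcomp f (qid x) = f;
  qle_refl : forall x y (f : qhom x y), qle f f;
  qle_trans : forall x y (g f h : qhom x y), qle f g -> qle g h -> qle f h;
  qle_anti : forall x y (f g : qhom x y), qle f g -> qle g f -> f = g;
  qsup_ub : forall x y (A : set (qhom x y)) f, A f -> qle f (qsup A);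
  qsup_lub : forall x y (A : set (qhom x y)) g,
    (forall f, A f -> qle f g) -> qle (qsup A) g;
  qcomp_supr : forall x y z (g : qhom y z) (A : set (qhom x y)),
    qcomp g (qsup A) = qsup [set qcomp g f | f in A];
  qcomp_supl : forall x y z (B : set (qhom y z)) (f : qhom x y),
    qcomp (qsup B) f = qsup [set qcomp g f | g in B] }.

Arguments qhom {q} x y : rename.
Arguments qid {q} x : rename.

Declare Scope quantaloid_scope.
Delimit Scope quantaloid_scope with Q.
Notation "g * f" := (qcomp g f) : quantaloid_scope.
Notation "f <= g" := (qle f g) : quantaloid_scope.
Local Open Scope quantaloid_scope.

Record involution (Q : quantaloid) := Involution {
  inv_fun : forall x y : Q, qhom x y -> qhom y x;
  inv_le : forall (x y : Q) (f g : qhom x y), f <= g -> inv_fun f <= inv_fun g;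
  inv_id : forall x : Q, inv_fun (qid x) = qid x;
  inv_comp : forall (x y z : Q) (g : qhom y z) (f : qhom x y),
    inv_fun (g * f) = inv_fun f * inv_fun g;
  inv_inv : forall (x y : Q) (f : qhom x y), inv_fun (inv_fun f) = f }.

Record inv_quantaloid := InvQuantaloid {
  base_quantaloid :> quantaloid;
  the_involution : involution base_quantaloid }.

Definition dag (Q : inv_quantaloid) (x y : Q) (f : qhom x y) : qhom y x :=
  inv_fun (the_involution Q) f.

Notation "f ^deg" := (dag f) (at level 1, format "f ^deg") : quantaloid_scope.

Definition qmeet (Q : quantaloid) (x y : Q) (f g : qhom x y) : qhom x y :=
  qsup [set h | h <= f /\ h <= g].

(* Supremum of a family indexed by the disjoint union of the sets [E x]. *)
Definition esup (Q : quantaloid) (E : Q -> Type) (y z : Q)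
    (phi : forall x, E x -> qhom y z) : qhom y z :=
  qsup [set h | exists x (a : E x), h = phi x a].

Definition adjoint_arrows (Q : quantaloid) (x y : Q) (f : qhom x y) (g : qhom y x) :
  Prop := qid x <= g * f /\ f * g <= qid y.

(* Right adjoints are unique, so [f^* = f^deg] says that [f^deg] is right
   adjoint to [f]. *)
Definition symmetric_map (Q : inv_quantaloid) (x y : Q) (f : qhom x y) : Prop :=
  adjoint_arrows f f^deg.

Section QuantaloidTheory.
Variable Q : inv_quantaloid.
Implicit Types x y z : Q.

Lemma qcomp_le x y z (g g' : qhom y z) (f f' : qhom x y) :
  g <= g' -> f <= f' -> g * f <= g' * f'.
Proof.
move=> gg' ff'; apply: (@qle_trans _ _ _ (g * f')).
- have <- : qsup [set h | h = f \/ h = f'] = f'.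
    apply: qle_anti; last by apply: qsup_ub; right.
    by apply: qsup_lub => h [-> | ->] //; apply: qle_refl.
  by rewrite qcomp_supr; apply: qsup_ub; exists f => //; left.
- have <- : qsup [set h | h = g \/ h = g'] = g'.
    apply: qle_anti; last by apply: qsup_ub; right.
    by apply: qsup_lub => h [-> | ->] //; apply: qle_refl.
  by rewrite qcomp_supl; apply: qsup_ub; exists g => //; left.
Qed.

Lemma dag_le x y (f g : qhom x y) : f <= g -> f^deg <= g^deg.
Proof. exact: inv_le. Qed.

Lemma dagK x y (f : qhom x y) : f^deg^deg = f.
Proof. exact: inv_inv. Qed.

Lemma dag_comp x y z (g : qhom y z) (f : qhom x y) : (g * f)^deg = f^deg * g^deg.
Proof. exact: inv_comp. Qed.

Lemma dag_id x : (qid x)^deg = qid x.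
Proof. exact: inv_id. Qed.

Lemma dag_le_swap x y (f : qhom x y) (g : qhom y x) : f^deg <= g -> f <= g^deg.
Proof. by move=> /dag_le; rewrite dagK. Qed.

Lemma qmeet_l x y (f g : qhom x y) : qmeet f g <= f.
Proof. by apply: qsup_lub => h []. Qed.

Lemma qmeet_r x y (f g : qhom x y) : qmeet f g <= g.
Proof. by apply: qsup_lub => h []. Qed.

Lemma qmeet_glb x y (f g h : qhom x y) : h <= f -> h <= g -> h <= qmeet f g.
Proof. by move=> hf hg; apply: qsup_ub. Qed.

Section ElementSup.
Variable E : Q -> Type.

Lemma esup_ub y z (phi : forall x, E x -> qhom y z) x (a : E x) : phi x a <= esup phi.
Proof. by apply: qsup_ub; exists x, a. Qed.

Lemma esup_ub_le y z (phi : forall x, E x -> qhom y z) h x (a : E x) : h <= phi x a -> h <= esup phi.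
Proof. by move=> ha; apply: qle_trans ha (esup_ub _ _). Qed.

Lemma esup_lub y z (phi : forall x, E x -> qhom y z) h : (forall x (a : E x), phi x a <= h) -> esup phi <= h.
Proof. by move=> ub; apply: qsup_lub => _ [x [a ->]]. Qed.

Lemma esup_compr w y z (phi : forall x, E x -> qhom y z) (g : qhom z w) :
  g * esup phi = esup (fun x (a : E x) => g * phi x a).
Proof.
apply: qle_anti.
- rewrite {1}/esup qcomp_supr; apply: qsup_lub => _ [_ [x [a ->]] <-].
  exact: (esup_ub (fun x (a : E x) => g * phi x a)).
- by apply: esup_lub => x a; apply: qcomp_le (qle_refl _) (esup_ub _ _).
Qed.

Lemma esup_compl w y z (phi : forall x, E x -> qhom y z) (g : qhom w y) :
  esup phi * g = esup (fun x (a : E x) => phi x a * g).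
Proof.
apply: qle_anti.
- rewrite {1}/esup qcomp_supl; apply: qsup_lub => _ [_ [x [a ->]] <-].
  exact: (esup_ub (fun x (a : E x) => phi x a * g)).
- by apply: esup_lub => x a; apply: qcomp_le (esup_ub _ _) (qle_refl _).
Qed.

Lemma dag_esup y z (phi : forall x, E x -> qhom y z) : (esup phi)^deg = esup (fun x (a : E x) => (phi x a)^deg).
Proof.
apply: qle_anti.
- rewrite -[X in _ <= X]dagK; apply: dag_le; apply: esup_lub => x a.
  by apply: dag_le_swap; apply: (esup_ub (fun x (a : E x) => (phi x a)^deg)).
- by apply: esup_lub => x a; apply: dag_le; apply: esup_ub.
Qed.

End ElementSup.

Lemma symmetric_map_id x : symmetric_map (qid x).
Proof. by rewrite /symmetric_map /adjoint_arrows dag_id qcomp1l; split; apply: qle_refl. Qed.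

Lemma symmetric_map_comp x y z (g : qhom y z) (f : qhom x y) :
  symmetric_map g -> symmetric_map f -> symmetric_map (g * f).
Proof.
move=> [g1 g2] [f1 f2]; split; rewrite dag_comp.
- rewrite -qcompA (qcompA _ g f); apply: qle_trans f1 _.
  by apply: qcomp_le (qle_refl _) _; rewrite -{1}(qcomp1l f); apply: qcomp_le g1 (qle_refl _).
- rewrite -qcompA (qcompA f); apply: qle_trans g2.
  apply: qcomp_le (qle_refl _) _; rewrite -[X in _ <= X](qcomp1l g^deg).
  exact: qcomp_le f2 (qle_refl _).
Qed.

End QuantaloidTheory.

Definition Maps (Q : inv_quantaloid) : category.
Proof.
refine (@Category Q (fun x y => {f : qhom x y | symmetric_map f})
  (fun x => exist _ (qid x) (symmetric_map_id x))
  (fun x y z g f => exist _ (sval g * sval f)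
     (symmetric_map_comp (svalP g) (svalP f))) _ _ _).
- by move=> w x y z h g f; apply: eq_exist; rewrite /= qcompA.
- by move=> x y [f mf]; apply: eq_exist; rewrite /= qcomp1l.
- by move=> x y [f mf]; apply: eq_exist; rewrite /= qcomp1r.
Defined.

Definition Psh (Q : inv_quantaloid) : category := functor_cat (opposite (Maps Q)) Sets.

Definition restr (Q : inv_quantaloid) (F : Psh Q) (x y : Q)
    (g : @hom (Maps Q) x y) : F y -> F x :=
  @fmap (opposite (Maps Q)) Sets F y x g.

Arguments restr {Q} F {x y} g a : rename.

(* The set A with its typing t : A -> Ob(Q) is encoded by the family of the
   fibres of t: [M x] is the set of the elements of type x, and A is their
   disjoint union. Type-preserving functions are families of functions. *)
Record qcat (Q : quantaloid) := QCat {
  el :> Q -> Type;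
  mx : forall x y, el x -> el y -> qhom y x;
  mx_comp : forall x y z (a : el x) (b : el y) (c : el z), mx a b * mx b c <= mx a c;
  mx_id : forall x (a : el x), qid x <= mx a a }.

Arguments mx {Q} M {x y} a b : rename.

Record qfunctor (Q : quantaloid) (M N : qcat Q) := QFunctor {
  qfun :> forall x, M x -> N x;
  qfun_le : forall x y (a : M x) (b : M y), mx M a b <= mx N (qfun a) (qfun b) }.

Arguments qfun {Q M N} q {x} _ : rename.

Lemma qfunctor_ext (Q : quantaloid) (M N : qcat Q) (f g : qfunctor M N) :
  (forall x (a : M x), f x a = g x a) -> f = g.
Proof.
case: f g => [f lf] [g lg] /= fg.
have e : f = g by do 2![apply: functional_extensionality_dep => ?]; apply: fg.
by subst g; congr QFunctor; apply: Prop_irrelevance.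
Qed.

Definition QCats (Q : quantaloid) : category.
Proof.
refine (@Category (qcat Q) (@qfunctor Q)
  (fun M => @QFunctor Q M M (fun _ a => a) (fun _ _ _ _ => qle_refl _))
  (fun M N P g f => @QFunctor Q M P (fun _ a => g _ (f _ a))
     (fun _ _ a b => qle_trans (qfun_le f a b) (qfun_le g _ _))) _ _ _).
- by move=> *; apply: qfunctor_ext.
- by move=> *; apply: qfunctor_ext.
- by move=> *; apply: qfunctor_ext.
Defined.

Section Enriched.
Variable Q : inv_quantaloid.

Definition is_symmetric (M : qcat Q) : Prop :=
  forall (x y : Q) (a : M x) (b : M y), mx M a b = (mx M b a)^deg.

Definition skeletal (M : qcat Q) : Prop :=
  forall (x : Q) (a a' : M x),
    (forall (y : Q) (c : M y), mx M c a = mx M c a') -> a = a'.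

Record is_singleton (M : qcat Q) (q : Q) (sigma : forall x : Q, M x -> qhom q x) :
    Prop := IsSingleton {
  sing_le : forall (x y : Q) (a : M x) (b : M y), mx M a b * sigma y b <= sigma x a;
  sing_id : qid q <= esup (fun x (a : M x) => (sigma x a)^deg * sigma x a);
  sing_mx : forall (x y : Q) (a : M x) (b : M y), sigma x a * (sigma y b)^deg <= mx M a b }.

Record singleton (M : qcat Q) (q : Q) := Singleton {
  sing :> forall x : Q, M x -> qhom q x;
  singP : is_singleton sing }.

Definition representable (M : qcat Q) (q : Q) (sigma : singleton M q) : Prop :=
  exists a : M q, forall (y : Q) (c : M y), sigma y c = mx M c a.

Definition sym_complete (M : qcat Q) : Prop :=
  forall (q : Q) (sigma : singleton M q), representable sigma.

Definition SymCats : category := @full_sub (QCats Q) is_symmetric.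

Definition Cat_sk : category :=
  @full_sub (QCats Q) (fun M => [/\ is_symmetric M, skeletal M & sym_complete M]).

Lemma singleton_ext (M : qcat Q) (q : Q) (s t : singleton M q) :
  (forall x (a : M x), s x a = t x a) -> s = t.
Proof.
case: s t => [s ps] [t pt] /= st.
have e : s = t by do 2![apply: functional_extensionality_dep => ?]; apply: st.
by subst t; congr Singleton; apply: Prop_irrelevance.
Qed.

Lemma yoneda_subproof (M : qcat Q) (symM : is_symmetric M) (q : Q) (a : M q) :
  is_singleton (fun x (c : M x) => mx M c a).
Proof.
split=> [x y c d||x y c d].
- exact: mx_comp.
- apply: (esup_ub_le (a := a)); rewrite -{1}(qcomp1l (qid q)).
  by apply: qcomp_le; rewrite -?symM; apply: mx_id.
- by rewrite -symM; apply: mx_comp.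
Qed.

Definition yoneda (M : qcat Q) (symM : is_symmetric M) (q : Q) (a : M q) :
  singleton M q := Singleton (yoneda_subproof symM a).

Section Completion.
Variables (M : qcat Q) (symM : is_symmetric M).

Lemma completion_comp_subproof (x y z : Q)
    (s : singleton M x) (t : singleton M y) (r : singleton M z) :
  esup (fun w (a : M w) => (s w a)^deg * t w a) *
  esup (fun w (a : M w) => (t w a)^deg * r w a) <=
  esup (fun w (a : M w) => (s w a)^deg * r w a).
Proof.
rewrite esup_compl; apply: esup_lub => w a; rewrite esup_compr; apply: esup_lub => v b.
apply: (esup_ub_le (a := a)); rewrite -qcompA; apply: qcomp_le (qle_refl _) _.
rewrite qcompA; apply: qle_trans (sing_le (singP r) a b).
by apply: qcomp_le (qle_refl _); apply: sing_mx; apply: singP.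
Qed.

Definition completion : qcat Q :=
  @QCat Q (singleton M)
    (fun x y s t => esup (fun w (a : M w) => (s w a)^deg * t w a))
    completion_comp_subproof
    (fun x s => sing_id (singP s)).

Lemma completion_sym : is_symmetric completion.
Proof.
move=> x y s t; rewrite /= dag_esup; congr esup.
do 2![apply: functional_extensionality_dep => ?].
by rewrite dag_comp dagK.
Qed.

Lemma completion_yoneda (x y : Q) (a : M x) (s : completion y) :
  mx completion (yoneda symM a : completion x) s = s x a.
Proof.
apply: qle_anti.
- by apply: esup_lub => w b /=; rewrite -symM; apply: (sing_le (singP s) _ _).
- apply: (esup_ub_le (a := a)) => /=; rewrite -symM -{1}(qcomp1l (s x a)).
  exact: qcomp_le (mx_id _) (qle_refl _).
Qed.

Lemma completion_skeletal : skeletal completion.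
Proof.
move=> q s t st; apply: singleton_ext => x a.
by rewrite -!completion_yoneda st.
Qed.

Lemma completion_complete : sym_complete completion.
Proof.
move=> q Phi; pose sigma x (a : M x) := Phi x (yoneda symM a).
have PhiE x (t : completion x) :
    Phi x t = esup (fun w (a : M w) => (t w a)^deg * sigma w a).
  apply: qle_anti.
  - rewrite -{1}(qcomp1l (Phi x t)).
    apply: qle_trans (qcomp_le (sing_id (singP t)) (qle_refl _)) _.
    rewrite esup_compl; apply: esup_lub => w a; apply: (esup_ub_le (a := a)).
    rewrite -qcompA; apply: qcomp_le (qle_refl _) _.
    by rewrite -completion_yoneda; apply: (sing_le (singP Phi) _ _).
  - apply: esup_lub => w a; rewrite -completion_yoneda.
    by rewrite -completion_sym; apply: (sing_le (singP Phi) _ _).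
have sigmaP : is_singleton sigma.
  split=> [x y a b||x y a b].
  - have <- : _ = mx M a b := completion_yoneda a (yoneda symM b).
    exact: (sing_le (singP Phi) _ _).
  - apply: qle_trans (sing_id (singP Phi)) _; apply: esup_lub => x t.
    rewrite {1}PhiE dag_esup esup_compl; apply: esup_lub => w a.
    apply: (esup_ub_le (a := a)); rewrite dag_comp dagK -qcompA.
    apply: qcomp_le (qle_refl _) _; rewrite -completion_yoneda.
    exact: (sing_le (singP Phi) _ _).
  - have <- : _ = mx M a b := completion_yoneda a (yoneda symM b).
    exact: (sing_mx (singP Phi) _ _).
by exists (Singleton sigmaP) => x t; apply: PhiE.
Qed.

End Completion.

Section CompletionMap.
Variables (M N : qcat Q) (symN : is_symmetric N) (f : qfunctor M N).

Lemma completion_map_subproof (q : Q) (s : singleton M q) :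
  is_singleton
    (fun x (c : N x) => esup (fun w (a : M w) => mx N c (f w a) * s w a)).
Proof.
split=> [x y c d||x y c d].
- rewrite esup_compr; apply: esup_lub => w a; apply: (esup_ub_le (a := a)).
  by rewrite qcompA; apply: qcomp_le (mx_comp _ _ _) (qle_refl _).
- apply: qle_trans (sing_id (singP s)) _; apply: esup_lub => w a.
  apply: (esup_ub_le (a := f w a)).
  have sle : s w a <= esup (fun v (b : M v) => mx N (f w a) (f v b) * s v b).
    apply: (esup_ub_le (a := a)); rewrite -{1}(qcomp1l (s w a)).
    exact: qcomp_le (mx_id _) (qle_refl _).
  by apply: qcomp_le => //; apply: dag_le.
- rewrite esup_compl; apply: esup_lub => w a.
  rewrite dag_esup esup_compr; apply: esup_lub => v b.
  rewrite dag_comp -symN -qcompA; apply: qle_trans (mx_comp _ (f w a) _).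
  apply: qcomp_le (qle_refl _) _; rewrite qcompA.
  apply: qle_trans (mx_comp _ (f v b) _); apply: qcomp_le (qle_refl _).
  exact: qle_trans (sing_mx (singP s) _ _) (qfun_le f _ _).
Qed.

Definition completion_fun (q : Q) (s : singleton M q) : singleton N q :=
  Singleton (completion_map_subproof s).

Lemma completion_fun_le (x y : Q) (s : singleton M x) (t : singleton M y) :
  mx (completion M) s t <= mx (completion N) (completion_fun s) (completion_fun t).
Proof.
apply: esup_lub => w a; apply: (esup_ub_le (a := f w a)).
have sle q (r : singleton M q) : r w a <= completion_fun r w (f w a).
  apply: (esup_ub_le (a := a)); rewrite -{1}(qcomp1l (r w a)).
  exact: qcomp_le (mx_id _) (qle_refl _).
by apply: qcomp_le => //; apply: dag_le.
Qed.

Definition completion_map : qfunctor (completion M) (completion N) :=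
  @QFunctor Q (completion M) (completion N) completion_fun completion_fun_le.

End CompletionMap.

Definition C_s : functor SymCats Cat_sk.
Proof.
refine (@Functor SymCats Cat_sk
  (fun M => exist _ (completion (sval M))
     (And3 (@completion_sym (sval M)) (@completion_skeletal (sval M) (svalP M))
           (@completion_complete (sval M) (svalP M))))
  (fun M N f => completion_map (svalP N) f) _ _).
- move=> [M symM]; apply: qfunctor_ext => q s; apply: singleton_ext => x c /=.
  apply: qle_anti.
  + by apply: esup_lub => w a; apply: (sing_le (singP s) _ _).
  + apply: (esup_ub_le (a := c)); rewrite -{1}(qcomp1l (s x c)).
    exact: qcomp_le (mx_id _) (qle_refl _).
- move=> [M symM] [N symN] [P symP] g f.
  apply: qfunctor_ext => q s; apply: singleton_ext => x c /=.
  apply: qle_anti; apply: esup_lub => w a.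
  + apply: (esup_ub_le (a := f w a)); apply: qcomp_le (qle_refl _) _.
    apply: (esup_ub_le (a := a)); rewrite -{1}(qcomp1l (s w a)).
    exact: qcomp_le (mx_id _) (qle_refl _).
  + rewrite esup_compr; apply: esup_lub => v b; apply: (esup_ub_le (a := b)).
    rewrite qcompA; apply: qcomp_le (qle_refl _).
    apply: qle_trans (mx_comp _ (g w a) _).
    exact: qcomp_le (qle_refl _) (qfun_le g _ _).
Defined.

Definition symmetrization (N : qcat Q) : qcat Q.
Proof.
refine (@QCat Q N (fun x y a b => qmeet (mx N a b) (mx N b a)^deg) _ _).
- move=> x y z a b c; apply: qmeet_glb.
  + apply: qle_trans (mx_comp _ b _); apply: qcomp_le; exact: qmeet_l.
  + apply: qle_trans (dag_le (mx_comp _ b _)); rewrite dag_comp.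
    apply: qcomp_le; exact: qmeet_r.
- move=> x a; apply: qmeet_glb; first exact: mx_id.
  by rewrite -{1}(dag_id x); apply: dag_le; apply: mx_id.
Defined.

Lemma symmetrization_sym (N : qcat Q) : is_symmetric (symmetrization N).
Proof.
move=> x y a b /=; apply: qle_anti.
- apply: dag_le_swap; apply: qmeet_glb.
  + by rewrite -[X in _ <= X]dagK; apply: dag_le; apply: qmeet_r.
  + by apply: dag_le; apply: qmeet_l.
- apply: qmeet_glb.
  + by rewrite -[X in _ <= X]dagK; apply: dag_le; apply: qmeet_r.
  + by apply: dag_le; apply: qmeet_l.
Qed.

Definition Symm : functor (QCats Q) SymCats.
Proof.
refine (@Functor (QCats Q) SymCats
  (fun N => exist _ (symmetrization N) (@symmetrization_sym N))
  (fun M N f => @QFunctor Q (symmetrization M) (symmetrization N)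
     (fun x a => f x a) _) _ _).
- by move=> N; apply: qfunctor_ext.
- by move=> M N P g f; apply: qfunctor_ext.
Unshelve.
move=> x y a b; apply: qmeet_glb.
- exact: qle_trans (qmeet_l _ _) (qfun_le f _ _).
- apply: qle_trans (qmeet_r _ _) _; apply: dag_le; exact: qfun_le.
Defined.

Definition sigma_mx (F : Psh Q) (x y : Q) (a : F x) (b : F y) : qhom y x :=
  qsup [set f | exists g : @hom (Maps Q) y x, restr F g a = b /\ f = sval g].

Definition sigma_cat (F : Psh Q) : qcat Q.
Proof.
refine (@QCat Q F (@sigma_mx F) _ _).
- move=> x y z a b c; rewrite /sigma_mx qcomp_supl.
  apply: qsup_lub => _ [_ [g [gab ->]] <-]; rewrite qcomp_supr.
  apply: qsup_lub => _ [_ [h [hbc ->]] <-]; apply: qsup_ub.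
  exists (compc g h); split=> //; rewrite -hbc -gab.
  by have := @fmapM _ _ F x y z h g; rewrite /restr /= => ->.
- move=> x a; apply: qsup_ub; exists (idc (x : Maps Q)); split=> //.
  by have := @fmap1 _ _ F x; rewrite /restr /= => ->.
Defined.

Definition Sigma : functor (Psh Q) (QCats Q).
Proof.
refine (@Functor (Psh Q) (QCats Q) sigma_cat
  (fun F G u => @QFunctor Q (sigma_cat F) (sigma_cat G) (fun x a => u x a) _) _ _).
- by move=> F; apply: qfunctor_ext.
- by move=> F G H v u; apply: qfunctor_ext.
Unshelve.
move=> x y a b; apply: qsup_lub => _ [g [gab ->]]; apply: qsup_ub.
exists g; split=> //; rewrite -gab.
exact: esym (f_equal (fun h => h a) (@naturality _ _ _ _ u x y g)).
Defined.

Definition SSigma : functor (Psh Q) SymCats := comp_functor Symm Sigma.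

Definition CSSigma : functor (Psh Q) Cat_sk := comp_functor C_s SSigma.

Section Action.
Variable M : Cat_sk.

Lemma action_subproof (x y : Q) (a : sval M y) (g : @hom (Maps Q) x y) :
  exists b : sval M x,
    forall z (c : sval M z), mx (sval M) c b = mx (sval M) c a * sval g.
Proof.
case: M a => [N [symN skN cN]] /= a.
have ag : is_singleton (fun z (c : N z) => mx N c a * sval g).
  case: g => [g [g1 g2]] /=; split=> [z w c d||z w c d].
  - by rewrite qcompA; apply: qcomp_le (mx_comp _ _ _) (qle_refl _).
  - apply: qle_trans g1 _; apply: (esup_ub_le (a := a)).
    have gle : g <= mx N a a * g.
      by rewrite -{1}(qcomp1l g); apply: qcomp_le (mx_id _) (qle_refl _).
    by apply: qcomp_le => //; apply: dag_le.
  - rewrite dag_comp -symN -qcompA; apply: qle_trans (mx_comp _ a _).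
    apply: qcomp_le (qle_refl _) _; rewrite qcompA.
    rewrite -[X in _ <= X](qcomp1l (mx N a d)).
    exact: qcomp_le g2 (qle_refl _).
have [b bE] := cN _ (Singleton ag).
by exists b => z c; rewrite -bE.
Qed.

(* Well-defined by completeness; unique since M is skeletal. *)
Definition action (x y : Q) (a : sval M y) (g : @hom (Maps Q) x y) : sval M x :=
  sval (cid (action_subproof a g)).

Lemma actionE (x y : Q) (a : sval M y) (g : @hom (Maps Q) x y) z (c : sval M z) :
  mx (sval M) c (action a g) = mx (sval M) c a * sval g.
Proof. exact: (svalP (cid (action_subproof a g))). Qed.

Lemma action_uniq (x y : Q) (a : sval M y) (g : @hom (Maps Q) x y) (b : sval M x) :
  (forall z (c : sval M z), mx (sval M) c b = mx (sval M) c a * sval g) ->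
  b = action a g.
Proof.
have [_ skM _] := svalP M => bE; apply: skM => z c.
by rewrite actionE bE.
Qed.

Definition P_psh : Psh Q.
Proof.
refine (@Functor (opposite (Maps Q)) Sets (fun x : Q => sval M x)
  (fun y x (g : @hom (Maps Q) x y) (a : sval M y) => action a g) _ _).
- move=> x; apply: functional_extensionality_dep => a; apply/esym/action_uniq => z c /=.
  by rewrite qcomp1r.
- move=> z y x h g; apply: functional_extensionality_dep => a; apply/esym/action_uniq.
  by move=> w c /=; rewrite !actionE qcompA.
Defined.

End Action.

Lemma action_natural (M N : Cat_sk) (f : hom M N) (x y : Q) (a : sval M y)
    (g : @hom (Maps Q) x y) :
  f x (action a g) = action (f y a) g.
Proof.
have [symM _ _] := svalP M; have [symN _ _] := svalP N.
have gle : sval g <= mx (sval M) a (action a g).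
  rewrite actionE -{1}(qcomp1l (sval g)).
  exact: qcomp_le (mx_id _) (qle_refl _).
have {}gle := qle_trans gle (qfun_le f _ _).
apply: action_uniq => z c; apply: qle_anti.
- have [g1 _] := svalP g.
  rewrite -{1}(qcomp1r (mx (sval N) c _)).
  apply: qle_trans (qcomp_le (qle_refl _) g1) _; rewrite qcompA.
  apply: qcomp_le (qle_refl _); apply: qle_trans (mx_comp _ (f x (action a g)) _).
  by apply: qcomp_le (qle_refl _) _; rewrite symN; apply: dag_le.
- by apply: qle_trans (mx_comp _ (f y a) _); apply: qcomp_le (qle_refl _) gle.
Qed.

Definition P_s : functor Cat_sk (Psh Q).
Proof.
refine (@Functor Cat_sk (Psh Q) P_psh
  (fun M N f => @NatTrans _ _ (P_psh M) (P_psh N) (fun x a => f x a) _) _ _).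
- by move=> M; apply: nat_trans_ext.
- by move=> L M N g f; apply: nat_trans_ext.
Unshelve.
move=> y x g; apply: functional_extensionality_dep => a; exact: action_natural.
Defined.

(* All maps are symmetric ones here. With arbitrary maps f, g the stated
   equivalence fails: in the powerset quantale of the additive group of
   integers, with trivial involution, every {n} is a map, but only {0} is a
   symmetric map. *)
Definition in_Cat_sk_f (M : Cat_sk) : Prop :=
  forall (y z : Q) (a : sval M y) (b : sval M z),
    mx (sval M) a b =
    qsup [set h | exists x (c : sval M x) (f : qhom x y) (g : qhom z x),
      [/\ symmetric_map f, symmetric_map g,
          f <= mx (sval M) a c, g <= mx (sval M) c b & h = f * g]].

Definition Cat_sk_f : category := full_sub in_Cat_sk_f.

Record family (F : Psh Q) (q : Q) := Family {
  idx : Type;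
  fam_type : idx -> Q;
  fam_el : forall i, F (fam_type i);
  fam_map : forall i, @hom (Maps Q) (fam_type i) q }.

Arguments fam_type {F q} f i : rename.
Arguments fam_el {F q} f i : rename.
Arguments fam_map {F q} f i : rename.

Definition covering (F : Psh Q) (q : Q) (X : family F q) : Prop :=
  qid q <= qsup [set sval (fam_map X i) * (sval (fam_map X i))^deg | i in setT].

Definition compatible (F : Psh Q) (q : Q) (X : family F q) : Prop :=
  forall i j : idx X,
    (sval (fam_map X i))^deg * sval (fam_map X j) <=
    mx (sval (SSigma F)) (fam_el X i) (fam_el X j).

Definition locally_representable (F : Psh Q) : Prop :=
  forall (q : Q) (sigma : singleton (sval (SSigma F)) q),
    exists X : family F q, covering X /\
      forall (y : Q) (a : F y) (i : idx X),
        sigma y a * sval (fam_map X i) = mx (sval (SSigma F)) a (fam_el X i).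

Definition unique_gluing (F : Psh Q) : Prop :=
  forall (q : Q) (X : family F q), covering X -> compatible X ->
    exists! x : F q, forall i : idx X, restr F (fam_map X i) x = fam_el X i.

Definition in_Psh_f (F : Psh Q) : Prop := locally_representable F /\ unique_gluing F.

Definition Psh_f : category := full_sub in_Psh_f.

(* eta_F sends x in F(q) to the representable singleton M(-,x), where M is the
   matrix of S Sigma F. *)
Definition unit_component (F : Psh Q) (q : Q) (x : F q) : P_s (CSSigma F) q :=
  yoneda (svalP (SSigma F)) x.

(* epsilon_M is induced by the identity-on-elements Q-functor S Sigma P M -> M:
   it sends a singleton sigma to the element of M representing its extension
   along this Q-functor. *)
Definition counit_spec (M : Cat_sk) (q : Q)
    (sigma : sval (CSSigma (P_s M)) q) (a : sval M q) : Prop :=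
  forall (y : Q) (c : sval M y),
    mx (sval M) c a = esup (fun x (b : sval M x) => mx (sval M) c b * sing sigma b).

End Enriched.

(* Main.v *)
From mathcomp Require Import ssreflect ssrfun ssrbool boolp classical_sets.
Require Import Defs.

(** Write M for the matrix of the symmetrization of Sigma F and N for the matrix
of Sigma F.

Let F be locally representable with unique gluing. Then, for every symmetric map f
from x to y and all a in F y, b in F x, the inequality f <= M(a,b) is equivalent
to F(f)(a) = b.
- If f <= M(a,b), then the two elements a and b, with the maps id and f, form a
  compatible covering family of y. Its gluing is a, because of the map id, and
  restricts to b along f ([sheaf_restr_eq]).
- Conversely put b := F(f)(a). Local representability of M(-,a) f gives a
  covering family (x_i, f_i) of x with f f_i <= M(a,x_i). By the first part
  F(f f_i)(a) = x_i, and (f f_i)^deg <= N(x_i,a) is bounded by the supremum of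
  the maps k with F(k)(x_i) = a. Each f_i k carries b to a, so
  f_i f_i^deg f^deg <= N(b,a), and the covering gives f^deg <= N(b,a)
  ([sheaf_le_restr]).
Hence M = N, the assignment of M(-,a) to a is natural and injective, and
gluing the covering family of a singleton shows that every singleton is of this
form ([sheaf_singleton_yoneda]). So the unit at F is invertible, and the entries of the
completion are those of M = N, suprema of symmetric maps ([sheaf_dense]).

On the other side, the condition that defines the subcategory of Q-categories says
that each M(a,b) is the supremum of the symmetric maps below it
([in_Cat_sk_fP]). In a symmetrically complete M these are the maps f with
a . f = b, so the symmetrization of Sigma (P M) is M itself ([dense_mxE]) and the
counit is invertible. Local representability of P M is completeness of M;
the gluing of (x_i, f_i) represents the singleton with value at c the supremum of the
arrows M(c,x_i) f_i^deg ([dense_unique_gluing]).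

The counit is the completion of the identity-on-elements Q-functor from the
symmetrization of Sigma (P M) to M, followed by the isomorphism from the completion
of M to M; it is natural in every symmetrically complete M. The unit need not be
natural for an arbitrary presheaf, so it is built only on the subcategory. *)

Set Implicit Arguments.
Unset Strict Implicit.
Unset Printing Implicit Defensive.

Local Open Scope classical_set_scope.
Local Open Scope quantaloid_scope.

Arguments fam_el {Q F q} f i : rename.
Arguments fam_map {Q F q} f i : rename.

(** * Isomorphisms of categories, presheaves and Q-categories *)

Section Categories.

Lemma is_iso_comp (C : category) (x y z : C) (g : hom y z) (f : hom x y) :
  is_iso g -> is_iso f -> is_iso (compc g f).
Proof.
move=> [g' [g'g gg']] [f' [f'f ff']]; exists (compc f' g'); split.
- by rewrite -compcA (compcA g') g'g comp1c.
- by rewrite -compcA (compcA f) ff' comp1c.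
Qed.

Lemma fmap_iso (C D : category) (F : functor C D) (x y : C) (f : hom x y) :
  is_iso f -> is_iso (fmap F f).
Proof.
by move=> [g [gf fg]]; exists (fmap F g); rewrite -!fmapM gf fg !fmap1.
Qed.

Lemma pointwise_bijective_iso (C : category) (F G : functor C Sets)
    (u : nat_trans F G) :
  (forall x (a b : F x), u x a = u x b -> a = b) ->
  (forall x (b : G x), exists a, u x a = b) ->
  @is_iso (functor_cat C Sets) F G u.
Proof.
move=> inj surj; pose v x (b : G x) := sval (cid (surj x b)).
have uv x b : u x (v x b) = b by exact: (svalP (cid (surj x b))).
have vnat x y (f : hom x y) : (fun b => v y (fmap G f b)) = (fun b => fmap F f (v x b)).
  apply: functional_extensionality_dep => b; apply: inj; rewrite uv.
  have := f_equal (fun h => h (v x b)) (naturality u f) => /= ->.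
  by rewrite uv.
exists (@NatTrans C Sets G F v vnat); split; apply: nat_trans_ext => x;
  apply: functional_extensionality_dep => a //=.
by apply: inj; rewrite uv.
Qed.

End Categories.

Section Theory.
Variable Q : inv_quantaloid.

(** * Symmetric maps below the entries of a symmetric matrix *)

Section SymmetricMatrices.
Variables (M : qcat Q) (symM : is_symmetric M).

Lemma le_mx_comp (x y z : Q) (a : M x) (b : M y) (c : M z)
    (f : qhom y x) (g : qhom z y) :
  f <= mx M a b -> g <= mx M b c -> f * g <= mx M a c.
Proof. by move=> fab gbc; apply: qle_trans (mx_comp _ b _); apply: qcomp_le. Qed.

Lemma le_mx_dag (x y : Q) (a : M x) (b : M y) (f : qhom y x) :
  f <= mx M a b -> f^deg <= mx M b a.
Proof. by rewrite (symM b a); apply: dag_le. Qed.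

Lemma le_mxl (x y : Q) (a : M x) (f : qhom y x) : f <= mx M a a * f.
Proof. by rewrite -{1}(qcomp1l f); apply: qcomp_le (mx_id _) (qle_refl _). Qed.

(** A symmetric map below M(a,b) exhibits b as the restriction of a along it. *)
Lemma mx_symmetric_map (x y : Q) (a : M y) (b : M x) (f : qhom x y) :
  symmetric_map f -> f <= mx M a b ->
  forall z (c : M z), mx M c b = mx M c a * f.
Proof.
move=> [f1 _] fab z c; apply: qle_anti.
- rewrite -{1}(qcomp1r (mx M c b)).
  apply: qle_trans (qcomp_le (qle_refl _) f1) _; rewrite qcompA.
  apply: qcomp_le (qle_refl _); apply: qle_trans (mx_comp _ b _).
  exact: qcomp_le (qle_refl _) (le_mx_dag fab).
- by apply: qle_trans (mx_comp _ a _); apply: qcomp_le (qle_refl _) fab.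
Qed.

End SymmetricMatrices.

Lemma completion_map_yoneda (M N : qcat Q) (symM : is_symmetric M)
    (symN : is_symmetric N) (f : qfunctor M N) (q : Q) (a : M q) :
  completion_fun symN f (yoneda symM a) = yoneda symN (f q a).
Proof.
apply: singleton_ext => x c /=; apply: qle_anti.
- apply: esup_lub => w b; apply: qle_trans (mx_comp _ (f w b) _).
  by apply: qcomp_le (qle_refl _) (qfun_le f _ _).
- apply: (esup_ub_le (a := a)); rewrite -{1}(qcomp1r (mx N c _)).
  exact: qcomp_le (qle_refl _) (mx_id _).
Qed.

Lemma qfunctor_iso (M N : Cat_sk Q) (f : hom M N) :
  (forall x y (a : sval M x) (b : sval M y),
     mx (sval M) a b = mx (sval N) (f x a) (f y b)) ->
  (forall x (b : sval N x), exists a, f x a = b) ->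
  is_iso f.
Proof.
have [symM skM _] := svalP M => ff surj.
pose g x (b : sval N x) := sval (cid (surj x b)).
have fg x b : f x (g x b) = b by exact: (svalP (cid (surj x b))).
have gle x y (a : sval N x) (b : sval N y) :
    mx (sval N) a b <= mx (sval M) (g x a) (g y b).
  by rewrite ff !fg; apply: qle_refl.
exists (@QFunctor Q (sval N) (sval M) g gle); split; apply: qfunctor_ext => x a //=.
by apply: skM => y c; rewrite !ff fg.
Qed.

(** * Covering families *)

Section Coverings.
Variables (F : Psh Q) (q : Q) (X : family F q).
Hypothesis covX : covering X.

Lemma covering_le (y : Q) (h k : qhom q y) :
  (forall i, h * sval (fam_map X i) * (sval (fam_map X i))^deg <= k) -> h <= k.
Proof.
move=> hk; rewrite -(qcomp1r h).
apply: qle_trans (qcomp_le (qle_refl _) covX) _.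
by rewrite qcomp_supr; apply: qsup_lub => _ [_ [i _ <-] <-]; rewrite qcompA.
Qed.

Lemma covering_le_id (h : qhom q q) :
  (forall i, sval (fam_map X i) * (sval (fam_map X i))^deg <= h) -> qid q <= h.
Proof. by move=> hX; apply: covering_le => i; rewrite qcomp1l. Qed.

Lemma covering_mono (y : Q) (h k : qhom q y) :
  (forall i, h * sval (fam_map X i) <= k * sval (fam_map X i)) -> h <= k.
Proof.
move=> hk; apply: covering_le => i.
apply: qle_trans (qcomp_le (hk i) (qle_refl _)) _.
have [_ f2] := svalP (fam_map X i).
by rewrite -qcompA -[X in _ <= X](qcomp1r k); apply: qcomp_le (qle_refl _) f2.
Qed.

End Coverings.

Lemma restr_id (F : Psh Q) (x : Q) (a : F x) : restr F (idc (x : Maps Q)) a = a.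
Proof. exact: (f_equal (fun h => h a) (fmap1 F x)). Qed.

Lemma restr_comp (F : Psh Q) (x y z : Q) (g : @hom (Maps Q) y z)
    (f : @hom (Maps Q) x y) (a : F z) :
  restr F (compc g f) a = restr F f (restr F g a).
Proof. exact: (f_equal (fun h => h a) (@fmapM _ _ F z y x f g)). Qed.

(** * Presheaves with local representability and unique gluing *)

Section Sheaves.
Variables (F : Psh Q) (HF : in_Psh_f F).

Let M : qcat Q := sval (SSigma Q F).
Let symM : is_symmetric M := svalP (SSigma Q F).

(** With [sheaf_le_restr], this identifies the symmetric maps below M(a,b) with
the maps that restrict a to b. *)
Lemma sheaf_restr_eq (x y : Q) (a : F y) (b : F x) (f : @hom (Maps Q) x y) :
  sval f <= mx M a b -> restr F f a = b.
Proof.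
move=> fab.
(* The compatible covering family {(a, id), (b, f)}, indexed by bool. *)
pose X := @Family Q F y bool (fun i => if i then y else x)
  (fun i => if i return F (if i then y else x) then a else b)
  (fun i => if i return @hom (Maps Q) (if i then y else x) y
            then idc (y : Maps Q) else f).
have covX : covering X.
  by apply: qsup_ub; exists true => //=; rewrite qcomp1l dag_id.
have comX : compatible X.
  move=> [] [] /=.
  - by rewrite dag_id qcomp1l; apply: (mx_id (q := M)).
  - by rewrite dag_id qcomp1l.
  - by rewrite qcomp1r; apply: (@le_mx_dag M symM).
  - exact: le_mx_comp (le_mx_dag symM fab) fab.
have [z [zX _]] := HF.2 _ X covX comX.
by have /= <- := zX false; have /= := zX true; rewrite restr_id => ->.
Qed.

(** The singleton M(-,a) f, obtained as the restriction along f of the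
representable singleton of a in the completion. *)
Let pullback (x y : Q) (a : F y) (f : @hom (Maps Q) x y) : singleton M x :=
  @action Q (CSSigma Q F) x y (yoneda symM a) f.

Lemma pullbackE (x y : Q) (a : F y) (f : @hom (Maps Q) x y) z (c : M z) :
  pullback a f z c = mx M c a * sval f.
Proof.
rewrite -(completion_yoneda symM c) /pullback.
have /= -> := @actionE Q (CSSigma Q F) x y (yoneda symM a) f z (yoneda symM c).
by have /= -> := completion_yoneda symM c (yoneda symM a).
Qed.

Lemma sheaf_le_restr (x y : Q) (a : F y) (f : @hom (Maps Q) x y) :
  sval f <= mx M a (restr F f a).
Proof.
have [X [covX XE]] := HF.1 _ (pullback a f).
apply: qmeet_glb; first by apply: qsup_ub; exists f.
apply: dag_le_swap.
rewrite -(qcomp1l (sval f)^deg).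
apply: qle_trans (qcomp_le covX (qle_refl _)) _.
rewrite qcomp_supl; apply: qsup_lub => _ [_ [i _ <-] <-].
pose fi := fam_map X i; rewrite -/fi.
have ffi : sval f * sval fi <= mx M a (fam_el X i).
  by rewrite -XE pullbackE; apply: qcomp_le (qle_refl _); apply: (@le_mxl M).
have ffi_restr : restr F fi (restr F f a) = fam_el X i.
  by rewrite -restr_comp; apply: sheaf_restr_eq.
(* Each map k with F(k)(x_i) = a in the supremum N(x_i,a) above (f f_i)^deg yields
   the map f_i k, which sends F(f)(a) to a. *)
have := le_mx_dag symM ffi; rewrite dag_comp -qcompA => dle.
apply: qle_trans (qcomp_le (qle_refl _) (qle_trans dle (qmeet_l _ _))) _.
rewrite qcomp_supr; apply: qsup_lub => _ [_ [k [kE ->]] <-].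
by apply: qsup_ub; exists (compc fi k); rewrite restr_comp ffi_restr.
Qed.

Lemma sheaf_mxE (x y : Q) (a : F x) (b : F y) : mx M a b = sigma_mx a b.
Proof.
apply: qle_anti; first exact: qmeet_l.
by apply: qsup_lub => _ [g [<- ->]]; apply: sheaf_le_restr.
Qed.

Lemma sheaf_yoneda_inj (x : Q) (a b : F x) :
  yoneda symM a = yoneda symM b -> a = b.
Proof.
move=> ab; rewrite -(restr_id a); apply: sheaf_restr_eq.
have <- : mx M a a = mx M a b := f_equal (fun s : singleton M x => s x a) ab.
exact: mx_id.
Qed.

Lemma sheaf_singleton_yoneda (q : Q) (s : singleton M q) :
  exists a : F q, yoneda symM a = s.
Proof.
have [X [covX XE]] := HF.1 _ s.
have fs i : (sval (fam_map X i))^deg <= s _ (fam_el X i).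
  have [_ f2] := svalP (fam_map X i).
  rewrite -(qcomp1r (s _ _)); apply: qle_trans (qcomp_le (qle_refl _) f2).
  by rewrite qcompA XE; apply: (@le_mxl M).
have comX : compatible X.
  by move=> i j; rewrite -XE; apply: qcomp_le (fs i) (qle_refl _).
have [z [zX _]] := HF.2 _ X covX comX.
exists z; apply: singleton_ext => x c /=.
have zE i : mx M c z * sval (fam_map X i) = s x c * sval (fam_map X i).
  rewrite XE; apply/esym/(@mx_symmetric_map M symM); first exact: svalP.
  by rewrite -(zX i); apply: sheaf_le_restr.
by apply: qle_anti; apply: (covering_mono covX) => i; rewrite zE; apply: qle_refl.
Qed.

Lemma unit_component_natural (x y : Q) (g : @hom (Maps Q) x y) (a : F y) :
  unit_component (restr F g a) = action (M := CSSigma Q F) (unit_component a) g.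
Proof.
apply: action_uniq; apply: mx_symmetric_map => /=.
- exact: completion_sym.
- exact: svalP.
- have := completion_yoneda symM a (yoneda symM (restr F g a)) => /= ->.
  exact: sheaf_le_restr.
Qed.

(** The unit at F; naturality in the object of Q uses both the local
representability and the gluing property of F. *)
Definition sheaf_unit : nat_trans F (P_s Q (CSSigma Q F)).
Proof.
refine (@NatTrans _ _ F (P_s Q (CSSigma Q F)) (fun q a => unit_component a) _).
move=> y x g; apply: functional_extensionality_dep => a.
exact: unit_component_natural.
Defined.

Lemma sheaf_unit_iso : @is_iso (Psh Q) F (P_s Q (CSSigma Q F)) sheaf_unit.
Proof.
apply: pointwise_bijective_iso => x.
- by move=> a b; apply: sheaf_yoneda_inj.
- by move=> s; apply: sheaf_singleton_yoneda.
Qed.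

End Sheaves.

(** A composite of two symmetric maps is one, and each symmetric map is its own
composite with an identity; so the factorization through an intermediate element
can be dropped. *)
Lemma in_Cat_sk_fP (M : Cat_sk Q) :
  in_Cat_sk_f M <->
  forall (y z : Q) (a : sval M y) (b : sval M z),
    mx (sval M) a b <=
    qsup [set f | symmetric_map f /\ f <= mx (sval M) a b].
Proof.
split=> [dM y z a b|dM y z a b].
- rewrite {1}dM; apply: qsup_lub => _ [x [c [f [g [mf mg fac gcb ->]]]]].
  apply: qsup_ub; split; first exact: symmetric_map_comp.
  exact: le_mx_comp fac gcb.
- apply: qle_anti.
  + apply: qle_trans (dM _ _ _ _) _; apply: qsup_lub => f [mf fab].
    apply: qsup_ub; exists y, a, (qid y), f; split=> //.
    * exact: symmetric_map_id.
    * exact: mx_id.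
    * by rewrite qcomp1l.
  + by apply: qsup_lub => _ [x [c [f [g [_ _ fac gcb ->]]]]]; apply: le_mx_comp fac gcb.
Qed.

Lemma sheaf_dense (F : Psh Q) : in_Psh_f F -> in_Cat_sk_f (CSSigma Q F).
Proof.
move=> HF; apply/in_Cat_sk_fP => y z s t.
have [a <-] := sheaf_singleton_yoneda HF s.
have [b <-] := sheaf_singleton_yoneda HF t.
have -> : mx (sval (CSSigma Q F)) (yoneda (svalP (SSigma Q F)) a)
             (yoneda (svalP (SSigma Q F)) b) = mx (sval (SSigma Q F)) a b.
  exact: completion_yoneda.
rewrite {1}(sheaf_mxE HF); apply: qsup_lub => _ [g [<- ->]]; apply: qsup_ub.
by split; [exact: svalP | exact: sheaf_le_restr].
Qed.

(** * The counit *)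

Section Counit.
Variable M : Cat_sk Q.

Let symM : is_symmetric (sval M). Proof. by have [] := svalP M. Qed.
Let skM : skeletal (sval M). Proof. by have [] := svalP M. Qed.
Let cM : sym_complete (sval M). Proof. by have [] := svalP M. Qed.

Lemma actionP (x y : Q) (a : sval M y) (b : sval M x) (f : @hom (Maps Q) x y) :
  action a f = b <-> sval f <= mx (sval M) a b.
Proof.
split=> [<-|fab]; first by rewrite actionE; apply: le_mxl.
by apply/esym/action_uniq; apply: mx_symmetric_map fab => //; apply: svalP.
Qed.

(** M as a symmetric Q-category, forgetting that it is skeletal and complete. *)
Definition sym_cat_of : SymCats Q := exist _ (sval M) symM.

Lemma sigma_P_le (x y : Q) (a : P_s Q M x) (b : P_s Q M y) :
  mx (sval (SSigma Q (P_s Q M))) a b <= mx (sval M) a b.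
Proof.
apply: qle_trans (qmeet_l _ _) _; apply: qsup_lub => _ [g [gab ->]].
exact/actionP.
Qed.

(** The identity on elements, from the symmetrization of Sigma (P M) to M. *)
Definition sigma_P_map : @hom (SymCats Q) (SSigma Q (P_s Q M)) sym_cat_of :=
  @QFunctor Q (sval (SSigma Q (P_s Q M))) (sval M) (fun _ a => a) sigma_P_le.

(** The element that represents a singleton of M. *)
Definition rep_fun (q : Q) (s : completion (sval M) q) : sval M q :=
  sval (cid (cM s)).

Lemma rep_funE (q : Q) (s : completion (sval M) q) y (c : sval M y) :
  mx (sval M) c (rep_fun s) = sing s c.
Proof. exact: esym (svalP (cid (cM s)) y c). Qed.

Lemma yoneda_rep_fun (q : Q) (s : completion (sval M) q) :
  yoneda symM (rep_fun s) = s.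
Proof. by apply: singleton_ext => y c; exact: (rep_funE s c). Qed.

Lemma rep_fun_yoneda (symM' : is_symmetric (sval M)) (q : Q) (a : sval M q) :
  rep_fun (yoneda symM' a) = a.
Proof. by apply: skM => y c; rewrite rep_funE. Qed.

Lemma mx_rep_fun (x y : Q) (s : completion (sval M) x) (t : completion (sval M) y) :
  mx (completion (sval M)) s t = mx (sval M) (rep_fun s) (rep_fun t).
Proof.
rewrite rep_funE -{1}(yoneda_rep_fun s).
exact: completion_yoneda.
Qed.

Lemma rep_fun_le (x y : Q) (s : completion (sval M) x) (t : completion (sval M) y) :
  mx (completion (sval M)) s t <= mx (sval M) (rep_fun s) (rep_fun t).
Proof. by rewrite mx_rep_fun; apply: qle_refl. Qed.

(** The isomorphism from the completion of M to M, inverse to the Yoneda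
embedding. *)
Definition rep : @hom (Cat_sk Q) (C_s Q sym_cat_of) M :=
  @QFunctor Q (completion (sval M)) (sval M) rep_fun rep_fun_le.

Lemma rep_iso : is_iso rep.
Proof.
apply: qfunctor_iso => [x y s t|x a]; first exact: mx_rep_fun.
by exists (yoneda symM a); apply: rep_fun_yoneda.
Qed.

(** The counit at an arbitrary symmetrically complete M. *)
Definition counit : @hom (Cat_sk Q) (CSSigma Q (P_s Q M)) M :=
  compc rep (fmap (C_s Q) sigma_P_map).

Lemma counitE (q : Q) (s : sval (CSSigma Q (P_s Q M)) q) :
  counit_spec s (counit q s).
Proof. by move=> y c; apply: rep_funE. Qed.

(** The triangle identity at M, elementwise. *)
Lemma counit_yoneda (q : Q) (a : P_s Q M q) : counit q (unit_component a) = a.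
Proof.
apply: etrans (rep_fun_yoneda (svalP sym_cat_of) a); congr rep_fun.
exact: completion_map_yoneda.
Qed.

(** * Matrices that are suprema of symmetric maps *)

Section Dense.
Hypothesis dM : in_Cat_sk_f M.

Lemma dense_mxE (x y : Q) (a : P_s Q M x) (b : P_s Q M y) :
  mx (sval (SSigma Q (P_s Q M))) a b = mx (sval M) a b.
Proof.
have le z w (c : P_s Q M z) (d : P_s Q M w) : mx (sval M) c d <= sigma_mx c d.
  apply: qle_trans ((in_Cat_sk_fP _).1 dM _ _ _ _) _.
  apply: qsup_lub => f [mf fcd]; apply: qsup_ub; exists (exist _ f mf); split=> //.
  exact/actionP.
apply: qle_anti; first exact: sigma_P_le.
by apply: qmeet_glb; [exact: le | rewrite symM; apply: dag_le; exact: le].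
Qed.

Lemma sigma_P_map_iso : is_iso sigma_P_map.
Proof.
have le x y (a : sval M x) (b : sval M y) :
    mx (sval M) a b <= mx (sval (SSigma Q (P_s Q M))) a b.
  by rewrite dense_mxE; apply: qle_refl.
exists (@QFunctor Q (sval M) (sval (SSigma Q (P_s Q M))) (fun _ a => a) le).
by split; apply: qfunctor_ext.
Qed.

Lemma counit_iso : is_iso counit.
Proof. exact: is_iso_comp rep_iso (fmap_iso _ sigma_P_map_iso). Qed.

Lemma dense_locally_representable : locally_representable (P_s Q M).
Proof.
move=> q s.
(* s is a singleton of M too, both matrices being equal. *)
have sM : @is_singleton Q (sval M) q (fun x a => s x a).
  split=> [x y a b||x y a b]; rewrite -?dense_mxE.
  - exact: (sing_le (singP s)).
  - exact: (sing_id (singP s)).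
  - exact: (sing_mx (singP s)).
have [a aE] := cM (Singleton sM).
(* The element a that represents s, with the identity, is the required cover. *)
pose X := @Family Q (P_s Q M) q unit (fun=> q) (fun=> a) (fun=> idc (q : Maps Q)).
exists X; split.
- by apply: qsup_ub; exists tt => //=; rewrite qcomp1l dag_id.
- move=> y c i; exact: etrans (qcomp1r _) (etrans (aE y c) (esym (dense_mxE c a))).
Qed.

Lemma dense_unique_gluing : unique_gluing (P_s Q M).
Proof.
move=> q X covX comX.
(* The singleton that the gluing has to represent. *)
pose sig y (c : sval M y) := qsup [set mx (sval M) c (fam_el X i : sval M _) *
  (sval (fam_map X i))^deg | i in setT].
have sig_ub y (c : sval M y) i :
    mx (sval M) c (fam_el X i : sval M _) * (sval (fam_map X i))^deg <= sig y c.
  by apply: qsup_ub; exists i.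
have fsig i : (sval (fam_map X i))^deg <= sig _ (fam_el X i).
  exact: qle_trans (le_mxl _ _) (sig_ub _ _ i).
have com i j : (sval (fam_map X i))^deg * sval (fam_map X j) <=
    mx (sval M) (fam_el X i : sval M _) (fam_el X j : sval M _).
  by rewrite -dense_mxE; apply: comX.
have sigf y (c : sval M y) i :
    sig y c * sval (fam_map X i) = mx (sval M) c (fam_el X i : sval M _).
  apply: qle_anti.
  - rewrite qcomp_supl; apply: qsup_lub => _ [_ [j _ <-] <-]; rewrite -qcompA.
    exact: le_mx_comp (qle_refl _) (com j i).
  - have [f1 _] := svalP (fam_map X i).
    rewrite -{1}(qcomp1r (mx _ c _)).
    apply: qle_trans (qcomp_le (qle_refl _) f1) _.
    by rewrite qcompA; apply: qcomp_le (qle_refl _).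
have sigP : is_singleton sig.
  split=> [x y a b||x y a b].
  - rewrite qcomp_supr; apply: qsup_lub => _ [_ [i _ <-] <-]; rewrite qcompA.
    exact: qle_trans (qcomp_le (mx_comp _ _ _) (qle_refl _)) (sig_ub _ _ i).
  - apply: (covering_le_id covX) => i; apply: (esup_ub_le (a := fam_el X i)).
    apply: qcomp_le (fsig i); rewrite -[X in X <= _]dagK.
    exact: dag_le (fsig i).
  - rewrite qcomp_supl; apply: qsup_lub => _ [_ [i _ <-] <-].
    rewrite -qcompA -dag_comp sigf -symM.
    exact: mx_comp.
have [a aE] := cM (Singleton sigP).
have aX i : restr (P_s Q M) (fam_map X i) a = fam_el X i.
  by apply/esym/action_uniq => z c; rewrite -aE sigf.
exists a; split=> // b bX; apply: skM => y c.
have abE i : mx (sval M) c a * sval (fam_map X i) = mx (sval M) c b * sval (fam_map X i).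
  by rewrite -!actionE; congr (mx _ c _); apply: etrans (aX i) (esym (bX i)).
by apply: qle_anti; apply: (covering_mono covX) => i; rewrite abE; apply: qle_refl.
Qed.

Lemma dense_sheaf : in_Psh_f (P_s Q M).
Proof. split; [exact: dense_locally_representable | exact: dense_unique_gluing]. Qed.

End Dense.
End Counit.

(** * Naturality and triangle identities *)

Lemma rep_natural (M N : Cat_sk Q) (h : hom M N) :
  compc (rep N) (fmap (C_s Q) (h : @hom (SymCats Q) (sym_cat_of M) (sym_cat_of N))) =
  compc h (rep M).
Proof.
apply: qfunctor_ext => q s /=.
rewrite -{1}(yoneda_rep_fun s) completion_map_yoneda.
exact: rep_fun_yoneda.
Qed.

Lemma counit_natural (M N : Cat_sk Q) (h : hom M N) :
  compc (counit N) (fmap (CSSigma Q) (fmap (P_s Q) h)) = compc h (counit M).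
Proof.
rewrite /counit compcA -rep_natural -2!compcA; congr (compc (rep N) _).
have naturality : compc (sigma_P_map N) (fmap (SSigma Q) (fmap (P_s Q) h)) =
    compc (c := SymCats Q) (x := SSigma Q (P_s Q M)) (y := sym_cat_of M)
      (z := sym_cat_of N) h (sigma_P_map M).
  exact: qfunctor_ext.
apply: etrans (esym (fmapM (C_s Q) _ _)) _.
rewrite naturality; exact: fmapM.
Qed.

Lemma unit_component_map (F G : Psh Q) (u : hom F G) (q : Q) (a : F q) :
  fmap (CSSigma Q) u q (unit_component a) = unit_component (u q a).
Proof. exact: completion_map_yoneda. Qed.

Lemma triangle_left (F : Psh Q) (HF : in_Psh_f F) :
  compc (counit (CSSigma Q F)) (fmap (CSSigma Q) (sheaf_unit HF : hom F _)) =
  idc (CSSigma Q F).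
Proof.
have [_ skC _] := svalP (CSSigma Q F).
have symM := svalP (SSigma Q F).
rewrite /counit -compcA.
have -> := esym (fmapM (C_s Q) (sigma_P_map (CSSigma Q F))
  (fmap (SSigma Q) (sheaf_unit HF : hom F _))).
apply: qfunctor_ext => q s; apply: skC => y t.
(* The composite of [sigma_P_map] and the unit is the Yoneda embedding, along
   which the extension of s evaluates at t to the supremum of the arrows
   t(a)^deg s(a). *)
apply: etrans (rep_funE _ _) _; congr esup.
apply: functional_extensionality_dep => x; apply: functional_extensionality_dep => a.
congr qcomp; have := completion_yoneda symM a t; rewrite /= => <-.
exact: completion_sym t (yoneda symM a).
Qed.

End Theory.

Theorem mainTheorem6 (Q : inv_quantaloid) :
  exists (HL : forall F : Psh Q, in_Psh_f F -> in_Cat_sk_f (CSSigma Q F))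
         (HP : forall M : Cat_sk Q, in_Cat_sk_f M -> in_Psh_f (P_s Q M))
         (E : adjoint_equivalence (restrict_functor HL) (restrict_functor HP)),
    (forall (F : Psh_f Q) (q : Q) (x : proj1_sig F q),
        ae_unit E F q x = unit_component x) /\
    (forall (M : Cat_sk_f Q) (q : Q)
            (sigma : proj1_sig (CSSigma Q (P_s Q (proj1_sig M))) q),
        counit_spec sigma (ae_counit E M q sigma)).
Proof.
pose HL := @sheaf_dense Q; pose HP := @dense_sheaf Q.
pose L := restrict_functor HL; pose P := restrict_functor HP.
have unit_nat (F G : Psh_f Q) (u : hom F G) :
    compc (c := Psh_f Q) (y := G) (z := P (L G)) (sheaf_unit (svalP G)) u =
    compc (c := Psh_f Q) (y := P (L F)) (fmap P (fmap L u)) (sheaf_unit (svalP F)).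
  apply: nat_trans_ext => q; apply: functional_extensionality_dep => a.
  exact: esym (unit_component_map u a).
have counit_nat (M N : Cat_sk_f Q) (h : hom M N) :
    compc (c := Cat_sk_f Q) (y := L (P N)) (z := N) (counit (sval N))
      (fmap L (fmap P h)) =
    compc (c := Cat_sk_f Q) (x := L (P M)) (y := M) h (counit (sval M)).
  exact: counit_natural.
have triangleR (M : Cat_sk_f Q) :
    compc (c := Psh_f Q) (x := P M) (y := P (L (P M)))
      (fmap P (counit (sval M) : @hom (Cat_sk_f Q) (L (P M)) M))
      (sheaf_unit (svalP (P M))) = idc (P M).
  apply: nat_trans_ext => q; apply: functional_extensionality_dep => a.
  exact: counit_yoneda.
pose E := @AdjointEquivalence (Psh_f Q) (Cat_sk_f Q) L P
  (@NatTrans _ _ (id_functor (Psh_f Q)) (comp_functor P L)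
     (fun F => sheaf_unit (svalP F)) unit_nat)
  (@NatTrans _ _ (comp_functor L P) (id_functor (Cat_sk_f Q))
     (fun M => counit (sval M)) counit_nat)
  (fun F => triangle_left (svalP F)) triangleR
  (fun F => sheaf_unit_iso (svalP F)) (fun M => counit_iso (svalP M)).
exists HL, HP, E; split=> [F q a|M q s] //.
exact: counitE.
Qed.
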